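(* Let $\pi\in\mathcal M_+^1(\Theta)$ be a prior distribution and $\epsilon\in(0,1)$. For any positive constants $\alpha,\gamma$ such that $\gamma<\alpha<1$, with $\mathbb P$ probability at least $1-\epsilon$, for any posterior distribution $\rho:\Omega\to\mathcal M_+^1(\Theta)$, the bound $$\begin{aligned}M(\rho)&=-\frac{\log[(1-\alpha)(1+\gamma)]}{\alpha-\gamma}\rho(r)+\frac{\mathcal K\bigl(\rho,\pi_{\exp[-N\log(1+\gamma)r]}\bigr)-2\log(\epsilon)}{N(\alpha-\gamma)}\\&=\frac{\mathcal K\bigl[\rho,\pi_{\exp[N\log(1-\alpha)r]}\bigr]+\int_{N\log(1+\gamma)}^{-N\log(1-\alpha)}\pi_{\exp(-\xi r)}(r)\,d\xi-2\log(\epsilon)}{N(\alpha-\gamma)}\end{aligned}$$ is such that $$\rho(R)\le\frac{\alpha-\gamma}{2\alpha\gamma}\Biggl(\sqrt{1+\frac{4\alpha\gamma}{(\alpha-\gamma)^2}\bigl\{1-\exp[-(\alpha-\gamma)M(\rho)]\bigr\}}-1\Biggr)\le M(\rho).$$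
   Context: Setting. $N\ge 1$ is an integer, $(\mathcal X,\mathcal B)$ a measurable space, $\mathcal Y$ a finite set with the algebra of all its subsets, $\Omega=(\mathcal X\times\mathcal Y)^N$ with coordinate process $(X_i,Y_i)_{i=1}^N$, and $\mathbb P=\bigotimes_{i=1}^N P_i$ a product of arbitrary (not necessarily identical) probability measures on $\mathcal X\times\mathcal Y$. $(\Theta,\mathcal T)$ is a measurable space and $(\theta,x)\mapsto f_\theta(x)\in\mathcal Y$ is measurable on $\Theta\times\mathcal X$. All $\sigma$-algebras are countably generated. Put $r(\theta)=\frac1N\sum_{i=1}^N\mathbf 1[f_\theta(X_i)\ne Y_i]$ and $R(\theta)=\frac1N\sum_{i=1}^N\mathbb P[f_\theta(X_i)\ne Y_i]$. $\mathcal M_+^1(\Theta)$ is the set of probability measures on $\Theta$; $\mu(h)=\int h\,d\mu$. A posterior distribution is a regular conditional probability measure $\rho:\Omega\to\mathcal M_+^1(\Theta)$ (it may depend on the sample); a prior does not depend on the sample. $\mathcal K(\rho,\pi)=\int\log(d\rho/d\pi)\,d\rho$ if $\rho\ll\pi$, $+\infty$ otherwise. For bounded measurable $h$, $d\pi_{\exp(h)}/d\pi=\exp(h)/\pi[\exp(h)]$. ''With probability at least $1-\epsilon$, for any $\rho$'' means that on an event of probability at least $1-\epsilon$ the inequality holds simultaneously for all $\rho$. *)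

(* Defs.v *)
From HB Require Import structures.
From mathcomp Require Import all_boot all_order all_algebra.
From mathcomp Require Import all_classical all_reals all_analysis.
From mathcomp Require Import measurable_realfun.
Set Implicit Arguments.
Unset Strict Implicit.
Unset Printing Implicit Defensive.
Import Order.TTheory GRing.Theory Num.Theory.
Import numFieldNormedType.Exports.
Local Open Scope classical_set_scope.
Local Open Scope ring_scope.
Local Open Scope charge_scope.
Local Open Scope ereal_scope.

Definition countably_generated d (T : measurableType d) : Prop :=
  exists2 G : set (set T), countable G & @measurable _ T = <<s G >>.

Section product_measure_tuple.
Context d (T : measurableType d) (R : realType).

Definition cons_pair n (p : T * n.-tuple T) : n.+1.-tuple T :=
  [the n.+1.-tuple T of p.1 :: p.2].

Lemma measurable_cons_pair n : measurable_fun [set: T * n.-tuple T] (@cons_pair n).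
Proof. by apply: measurable_cons. Qed.

HB.instance Definition _ n :=
  @isMeasurableFun.Build _ _ _ _ (@cons_pair n) (@measurable_cons_pair n).

Definition prod2 n (p : probability T R) (q : probability (n.-tuple T) R) :
  set (T * n.-tuple T) -> \bar R := p \x q.

HB.instance Definition _ n p q := Measure.on (@prod2 n p q).

Let prod2_setT n p q : @prod2 n p q [set: _] = 1.
Proof.
rewrite /prod2 -setXTT [LHS]product_measure1E//.
by rewrite [X in X * _]probability_setT [X in _ * X]probability_setT mule1.
Qed.

HB.instance Definition _ n p q :=
  Measure_isProbability.Build _ _ _ (@prod2 n p q) (@prod2_setT n p q).

(* The product P_1 (x) ... (x) P_n of possibly different probability measures,
   built from binary products by identifying T * T^n with T^(n+1). *)
Fixpoint prod_prob n : ('I_n -> probability T R) -> probability (n.-tuple T) R :=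
  match n return ('I_n -> probability T R) -> probability (n.-tuple T) R with
  | 0%N => fun=> dirac [tuple]
  | n'.+1 => fun P => distribution
      (prod2 (P ord0) (prod_prob (fun i => P (lift ord0 i)))) (@cons_pair n')
  end.

Lemma measurable_box n (A : 'I_n -> set T) : (forall i, measurable (A i)) ->
  measurable [set w : n.-tuple T | forall i, A i (tnth w i)].
Proof.
move=> mA.
rewrite (_ : [set _ | _] =
  \bigcap_(i in [set: 'I_n]) ((@tnth _ T)^~ i @^-1` A i)); last first.
  by apply/seteqP; split=> w /= Aw i => [_|]; apply: Aw.
apply: fin_bigcap_measurable => // i _.
by rewrite -[X in measurable X]setTI; apply: measurable_tnth.
Qed.

Lemma prod_prob_box n (P : 'I_n -> probability T R) (A : 'I_n -> set T) :
  (forall i, measurable (A i)) ->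
  prod_prob P [set w | forall i, A i (tnth w i)] = \prod_(i < n) P i (A i).
Proof.
elim: n P A => [|n IH] P A mA.
  rewrite big_ord0 /= diracE mem_set//= => -[].
  by case.
rewrite big_ord_recl /= /distribution /pushforward /=.
rewrite -(IH (fun i => P (lift ord0 i)) (fun i => A (lift ord0 i)))//.
rewrite -product_measure1E//; last first.
  exact: (measurable_box (fun i => mA (lift ord0 i))).
congr (prod2 _ _ _); apply/seteqP; split=> -[x w] /=.
  move=> H; split; first by have := H ord0.
  by move=> i; have := H (lift ord0 i); rewrite tnthS.
move=> [Ax Aw] i; have [j ->|->] := unliftP ord0 i; last by [].
by rewrite tnthS.
Qed.

End product_measure_tuple.

Section kernel_at.
Context d d' (X : measurableType d) (Y : measurableType d') (R : realType).
Variables (rho : R.-pker X ~> Y) (x : X).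

Definition kernel_at : set Y -> \bar R := rho x.

HB.instance Definition _ := Measure.on kernel_at.

HB.instance Definition _ :=
  Measure_isProbability.Build _ _ _ kernel_at (prob_kernel x).

End kernel_at.

Section divergence_and_gibbs.
Context d (T : measurableType d) (R : realType).

(* [lne 0 = -oo] is harmless here: the density vanishes only on a [rho]-null
   set, and the negative part of the integrand is [rho]-integrable, so that the
   integral is well defined in [\bar R]. *)
Definition kullback (rho pi : probability T R) : \bar R :=
  if `[< rho `<< pi >] then
    \int[rho]_t lne (('d (charge_of_finite_measure rho) '/d pi) t)
  else +oo.

(* Only measurable exponents are meaningful; any other one is replaced by 0 so
   that the tilted set function below is a measure for every [h]. *)
Definition measurable_exponent (h : T -> R) : T -> R :=
  if `[< measurable_fun [set: T] h >] then h else cst 0%R.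

Lemma measurable_exponentP h : measurable_fun [set: T] (measurable_exponent h).
Proof. by rewrite /measurable_exponent; case: ifPn => // /asboolP. Qed.

Definition exp_tilt (pi : probability T R) (h : T -> R) (A : set T) : \bar R :=
  \int[pi]_(t in A) (expR (measurable_exponent h t))%:E.

Section exp_tilt_measure.
Variables (pi : probability T R) (h : T -> R).

Let exp_tilt0 : exp_tilt pi h set0 = 0.
Proof. by rewrite /exp_tilt integral_set0. Qed.

Let exp_tilt_ge0 A : 0 <= exp_tilt pi h A.
Proof. by apply: integral_ge0 => t _; rewrite lee_fin expR_ge0. Qed.

Let measurable_density :
  measurable_fun [set: T] (EFin \o (expR \o measurable_exponent h)).
Proof.
apply/measurable_EFinP; apply: measurableT_comp => //.
exact: measurable_exponentP.
Qed.

Let exp_tilt_sigma_additive : semi_sigma_additive (exp_tilt pi h).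
Proof.
move=> F mF tF mUF; rewrite /exp_tilt ge0_integral_bigcup//; last exact: measurable_funTS.
by apply: is_cvg_ereal_nneg_natsum_cond => n _ _; exact: exp_tilt_ge0.
Qed.

HB.instance Definition _ := isMeasure.Build _ _ _ (exp_tilt pi h)
  exp_tilt0 exp_tilt_ge0 exp_tilt_sigma_additive.

End exp_tilt_measure.

(* pi_{exp(h)}; the default value [pi] of [mnormalize] is only reached when
   pi[exp(h)] is infinite, which cannot happen for a bounded [h]. *)
Definition gibbs (pi : probability T R) (h : T -> R) : probability T R :=
  mnormalize (exp_tilt pi h) pi.

Lemma gibbsE (pi : probability T R) (h : T -> R) (A : set T) :
  measurable_fun [set: T] h -> (exists C : R, forall t, (`|h t| <= C)%R) ->
  measurable A ->
  gibbs pi h A = \int[pi]_(t in A)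
    (expR (h t) / fine (\int[pi]_s (expR (h s))%:E))%:E.
Proof.
move=> mh [C hC] mA.
have hE : measurable_exponent h = h.
  by rewrite /measurable_exponent; case: ifPn => // /asboolP.
have mexp B : measurable B -> measurable_fun B (EFin \o (expR \o h)).
  by move=> mB; apply/measurable_EFinP; apply: measurableT_comp => //;
    exact: measurable_funTS.
pose Z := \int[pi]_s (expR (h s))%:E.
have ZE : exp_tilt pi h [set: T] = Z by rewrite /exp_tilt hE.
have Zlb : (expR (- C))%:E <= Z.
  rewrite -[leLHS]mule1 -[X in _ * X](@probability_setT _ _ _ pi) -integral_cst//.
  apply: ge0_le_integral => //=.
  - exact: mexp.
  - move=> t _; rewrite lee_fin ler_expR.
    by have := hC t; rewrite ler_norml => /andP[].
have Zub : Z <= (expR C)%:E.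
  rewrite -[leRHS]mule1 -[X in _ * X](@probability_setT _ _ _ pi) -integral_cst//.
  apply: ge0_le_integral => //=.
  - exact: mexp.
  - move=> t _; rewrite lee_fin ler_expR.
    by have := hC t; rewrite ler_norml => /andP[].
have Z0 : 0 < Z by rewrite (lt_le_trans _ Zlb)// lte_fin expR_gt0.
have Zoo : Z < +oo by rewrite (le_lt_trans Zub)// ltry.
have -> : gibbs pi h A = exp_tilt pi h A * (fine Z)^-1%:E.
  transitivity ((if (exp_tilt pi h setT == 0) || (exp_tilt pi h setT == +oo)
    then fun U => pi U
    else fun U => exp_tilt pi h U * (fine (exp_tilt pi h setT))^-1%:E) A) => //.
  by rewrite ZE (gt_eqF Z0) (lt_eqF Zoo).
rewrite /exp_tilt hE.
under [RHS]eq_integral do rewrite EFinM.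
rewrite ge0_integralZr//; first exact: mexp.
by rewrite lee_fin invr_ge0 fine_ge0// ltW.
Qed.

End divergence_and_gibbs.

Section classification.
Context d dX dY (Theta : measurableType d) (X : measurableType dX)
  (Y : measurableType dY) (R : realType) (N : nat).
Variable f : Theta -> X -> Y.

Definition emp_risk (w : N.-tuple (X * Y)) (t : Theta) : R :=
  (N%:R^-1 * \sum_(i < N) (f t (tnth w i).1 != (tnth w i).2)%:R)%R.

Definition exp_risk (P : probability (N.-tuple (X * Y)) R) (t : Theta) : R :=
  (N%:R^-1 * \sum_(i < N)
     fine (P [set w | f t (tnth w i).1 != (tnth w i).2]))%R.

(* The two expressions of M(rho), as extended reals: both are [+oo] when the
   divergence is. *)
Definition bound1 (pi rho : probability Theta R) (w : N.-tuple (X * Y))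
    (eps alpha gamma : R) : \bar R :=
  (- (ln ((1 - alpha) * (1 + gamma)) / (alpha - gamma)))%:E *
    \int[rho]_t (emp_risk w t)%:E +
  (kullback rho (gibbs pi (fun t => - (N%:R * ln (1 + gamma) * emp_risk w t))%R)
     - (2 * ln eps)%:E) * ((N%:R * (alpha - gamma))^-1)%:E.

Definition bound2 (pi rho : probability Theta R) (w : N.-tuple (X * Y))
    (eps alpha gamma : R) : \bar R :=
  (kullback rho (gibbs pi (fun t => N%:R * ln (1 - alpha) * emp_risk w t)%R)
   + \int[lebesgue_measure]_(xi in
       `[(N%:R * ln (1 + gamma))%R, (- (N%:R * ln (1 - alpha)))%R])
       \int[gibbs pi (fun t => - (xi * emp_risk w t))%R]_t (emp_risk w t)%:E
   - (2 * ln eps)%:E) * ((N%:R * (alpha - gamma))^-1)%:E.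

End classification.

Definition risk_bound (R : realType) (alpha gamma : R) (M : \bar R) : \bar R :=
  ((alpha - gamma) / (2 * alpha * gamma))%:E *
  (sqrte (1 + (4 * alpha * gamma / (alpha - gamma) ^+ 2)%:E *
              (1 - expeR (- ((alpha - gamma)%:E * M)))) - 1).

(* Main.v *)
Require Import Defs.
From HB Require Import structures.
From mathcomp Require Import all_boot all_order all_algebra.
From mathcomp Require Import all_classical all_reals all_analysis.
From mathcomp Require Import measurable_realfun ring lra.
Import Order.TTheory GRing.Theory Num.Theory.
Import numFieldNormedType.Exports.
Local Open Scope classical_set_scope.
Local Open Scope ring_scope.
Local Open Scope ereal_scope.

(** Put q(x) = (1 - alpha x)(1 + gamma x)
             = 1 - (alpha - gamma) x - alpha gamma x^2.
    The middle term of the claim is the nonnegative root of the equation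
    q(x) = exp(-(alpha - gamma) M), so that the first inequality amounts to
    - N ln q(rho(R)) <= N (alpha - gamma) M. As ln q is concave
    ([jensen_ln_quadratic]), it is enough to bound rho(- N ln q(R)).

    For every c > -1 the variable exp(N ln(1 + c) r(theta)) is a product of N
    independent factors 1 + c 1[f_theta(X_i) <> Y_i]; its expectation is the
    product of the 1 + c p_i, where R(theta) is the mean of the p_i, hence is
    at most (1 + c R(theta))^N by the inequality of arithmetic and geometric
    means ([emp_risk_moment]). This is used for two values of c.
    - For c = -alpha, the Donsker-Varadhan inequality turns it into an upper
      bound of rho(- N ln(1 - alpha R)) by the empirical risk and a divergence
      from any prior that does not depend on the sample. The prior
      pi_exp(- N ln(1 + gamma R)) is the one that also produces the term
      rho(- N ln(1 + gamma R)) of - N ln q(R).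
    - For c = gamma, it lets the normalising constant of this unobservable
      prior be compared with that of pi_exp(- N ln(1 + gamma) r), the
      observable prior of the statement.
    Each of the two steps bounds a random variable of mean at most 1. Rather
    than two events there is only one, given by Markov's inequality for the
    average of the two variables ([two_weight_event]); on it their product is
    at most 1 / eps^2, which explains the term - 2 ln eps
    ([ln_le_of_two_weights], [two_weight_variational]).

    For the second inequality, rho(R) >= 0 forces q(rho(R)) <= 1 and therefore
    M >= 0, after which 1 - exp(-u) <= u is enough ([quadratic_root_le]).

    The two expressions of M agree ([bound1_bound2]) because
    K(rho, pi_exp(h)) = K(rho, pi) + ln pi(exp h) - rho(h), for an infinite
    divergence too ([kullback_gibbs]), and because pi_exp(-xi r)(r) is minus the
    derivative of ln pi(exp(-xi r)) with respect to xi ([integral_gibbs_mean]). *)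

Set Implicit Arguments.
Unset Strict Implicit.
Unset Printing Implicit Defensive.

(** * Bounded measurable functions *)

Section bounded_measurable_functions.
Local Open Scope ring_scope.
Context d (T : measurableType d) (R : realType).
Implicit Types (g h : T -> R) (mu : probability T R).

Definition bounded_measurable g : Prop :=
  measurable_fun [set: T] g /\ exists C, forall t, `|g t| <= C.

Lemma bmeas_cst (c : R) : bounded_measurable (fun=> c).
Proof. by split; [exact: measurable_cst|exists `|c|]. Qed.

Lemma bmeasD g h : bounded_measurable g -> bounded_measurable h -> bounded_measurable (fun t => g t + h t).
Proof.
move=> [mg [C hC]] [mh [D hD]]; split; first exact: measurable_funD.
by exists (C + D) => t; rewrite (le_trans (ler_normD _ _))// lerD.
Qed.

Lemma bmeasM g h : bounded_measurable g -> bounded_measurable h -> bounded_measurable (fun t => g t * h t).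
Proof.
move=> [mg [C hC]] [mh [D hD]]; split; first exact: measurable_funM.
by exists (C * D) => t; rewrite normrM ler_pM.
Qed.

Lemma bmeasN g : bounded_measurable g -> bounded_measurable (fun t => - g t).
Proof.
move=> [mg [C hC]]; split; first exact: measurableT_comp.
by exists C => t; rewrite normrN.
Qed.

Lemma bmeasB g h : bounded_measurable g -> bounded_measurable h -> bounded_measurable (fun t => g t - h t).
Proof. by move=> bg /bmeasN; exact: bmeasD. Qed.

Lemma bmeas_expR g : bounded_measurable g -> bounded_measurable (fun t => expR (g t)).
Proof.
move=> [mg [C hC]]; split; first exact: measurableT_comp.
exists (expR C) => t; rewrite ger0_norm ?expR_ge0// ler_expR.
exact: le_trans (ler_norm _) (hC t).
Qed.

Lemma bmeas_ln g (a : R) : 0 < a -> (forall t, a <= g t) -> bounded_measurable g ->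
  bounded_measurable (fun t => ln (g t)).
Proof.
move=> a0 ag [mg [C hC]]; split; first exact: measurableT_comp.
exists (`|ln a| + `|ln C|) => t; have gt0 : 0 < g t := lt_le_trans a0 (ag t).
have gC : g t <= C := le_trans (ler_norm _) (hC t).
have la : ln a <= ln (g t) by rewrite ler_ln ?posrE.
have lC : ln (g t) <= ln C by rewrite ler_ln ?posrE// (lt_le_trans gt0).
have := ler_norm (ln C); have := ler_norm (- ln a); rewrite normrN.
have := normr_ge0 (ln a); have := normr_ge0 (ln C).
by rewrite ler_norml; lra.
Qed.

Lemma bmeas_integrable mu g : bounded_measurable g -> mu.-integrable [set: T] (EFin \o g).
Proof.
move=> [mg [C hC]]; apply: measurable_bounded_integrable => //.
  by rewrite (le_lt_trans (probability_le1 mu measurableT)) ?ltry.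
exists C; split; first exact: num_real.
by move=> x Cx t _; exact: le_trans (hC t) (ltW Cx).
Qed.

Lemma bmeas_RintegralE mu g : bounded_measurable g ->
  (\int[mu]_t (g t)%:E = (\int[mu]_t g t)%R%:E)%E.
Proof.
by move=> bg; rewrite /Rintegral fineK//; exact/integrable_fin_num/bmeas_integrable.
Qed.

Lemma bmeas_RintegralD mu g h : bounded_measurable g -> bounded_measurable h ->
  \int[mu]_t (g t + h t) = \int[mu]_t g t + \int[mu]_t h t.
Proof. by move=> *; rewrite RintegralD//; exact: bmeas_integrable. Qed.

Lemma bmeas_RintegralB mu g h : bounded_measurable g -> bounded_measurable h ->
  \int[mu]_t (g t - h t) = \int[mu]_t g t - \int[mu]_t h t.
Proof. by move=> *; rewrite RintegralB//; exact: bmeas_integrable. Qed.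

Lemma bmeas_RintegralZl mu c g : bounded_measurable g ->
  \int[mu]_t (c * g t) = c * \int[mu]_t g t.
Proof. by move=> *; rewrite RintegralZl//; exact: bmeas_integrable. Qed.

Lemma prob_Rintegral_cst mu (c : R) : \int[mu]_t c = c.
Proof. by rewrite Rintegral_cst// [X in fine X](@probability_setT _ _ _ mu) mulr1. Qed.

Lemma bmeas_le_Rintegral mu g h : bounded_measurable g -> bounded_measurable h ->
  (forall t, g t <= h t) -> \int[mu]_t g t <= \int[mu]_t h t.
Proof. by move=> bg bh gh; apply: le_Rintegral => //; exact: bmeas_integrable. Qed.

Lemma Rintegral_expR_gt0 mu g : bounded_measurable g -> 0 < \int[mu]_t expR (g t).
Proof.
move=> bg; have [_ [C hC]] := bg.
apply: (@lt_le_trans _ _ (expR (- C))); first exact: expR_gt0.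
rewrite -[leLHS](prob_Rintegral_cst mu).
apply: bmeas_le_Rintegral; [exact: bmeas_cst|exact: bmeas_expR|move=> t].
by rewrite ler_expR; have := hC t; rewrite ler_norml => /andP[].
Qed.

End bounded_measurable_functions.

(** * Densities and the nonnegativity of the divergence *)

Lemma measurable_lne (R : realType) : measurable_fun [set: \bar R] (@lne R).
Proof.
rewrite (_ : @lne R = fun x => if x <= 0 then -oo else
    if x == +oo then +oo else (ln (fine x))%:E); last first.
  by apply/funext => -[r| |] /=; rewrite ?lee_fin ?leNye.
apply: (@measurable_fun_ifT _ _ _ _ (cst -oo)
  (fun x => if x == +oo then +oo else (ln (fine x))%:E)
  (fun x : \bar R => x <= 0)) => //.
  by apply: measurable_fun_lee; [exact: measurable_id|exact: measurable_cst].
apply: (@measurable_fun_ifT _ _ _ _ (cst +oo)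
  (fun x => (ln (fine x))%:E) (fun x : \bar R => x == +oo)) => //.
  by apply: measurable_fun_eqe; [exact: measurable_id|exact: measurable_cst].
by apply/measurable_EFinP; apply: measurableT_comp => //; exact: measurable_fine.
Qed.

(** This is ln y <= y - 1 at y = 1 / x. *)
Lemma oppr_ln_le (R : realType) (x : R) :
  (0 < x -> - ln x <= x^-1 - 1)%R.
Proof.
move=> x0; have xV : (0 < x^-1)%R by rewrite invr_gt0.
by rewrite -lnV// -[X in ln X](subrK 1%R) addrC le_ln1Dx//; lra.
Qed.

Section density.
Local Open Scope charge_scope.
Context d (T : measurableType d) (R : realType).
Implicit Types rho sigma : probability T R.

Lemma prob_integral1 sigma : \int[sigma]_t 1 = 1.
Proof. by rewrite integral_cst// mul1e [LHS](@probability_setT _ _ _ sigma). Qed.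

(** Densities are real-valued and nonnegative everywhere, whereas the derivative
    that [kullback] uses is nonnegative almost everywhere only; inequalities on
    the logarithm can then be stated pointwise. *)
Definition is_density rho sigma (p : T -> R) :=
  [/\ measurable_fun [set: T] p, forall t, (0 <= p t)%R &
    forall A, measurable A -> rho A = \int[sigma]_(t in A) (p t)%:E].

Lemma is_density_dominates rho sigma p :
  is_density rho sigma p -> rho `<< sigma.
Proof.
move=> [mp p0 dp]; apply/null_content_dominatesP => A mA sA0.
by rewrite dp// null_set_integral//; exact/measurable_funTS/measurable_EFinP.
Qed.

Lemma is_density_exists rho sigma :
  rho `<< sigma -> exists p, is_density rho sigma p.
Proof.
move=> rs; pose f := Radon_Nikodym_SigmaFinite.f rho sigma.
have fE t : (fine (f t))%:E = f t.
  by rewrite fineK// Radon_Nikodym_SigmaFinite.f_fin_num.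
exists (fine \o f); split.
- apply/measurable_EFinP; rewrite (_ : EFin \o _ = f); last exact/funext.
  exact: measurable_int (Radon_Nikodym_SigmaFinite.f_integrable rs).
- by move=> t; rewrite fine_ge0//; exact: Radon_Nikodym_SigmaFinite.f_ge0.
- move=> A mA; rewrite (Radon_Nikodym_SigmaFinite.f_integral rs)//.
  by apply: eq_integral => t _; rewrite /= fE.
Qed.

Section density_facts.
Variables (rho sigma : probability T R) (p : T -> R).
Hypothesis dp : is_density rho sigma p.

Let mp : measurable_fun [set: T] (EFin \o p).
Proof. by case: dp => mp _ _; exact/measurable_EFinP. Qed.

Let p0 t : (0 <= p t)%R. Proof. by case: dp. Qed.

Lemma integral_density : \int[sigma]_t (p t)%:E = 1.
Proof. by case: dp => _ _ <-//; rewrite probability_setT. Qed.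

Let ip : sigma.-integrable [set: T] (EFin \o p).
Proof.
apply/integrableP; split=> //.
under eq_integral => t _ do rewrite /= ger0_norm//.
by rewrite integral_density ltry.
Qed.

(** The value +oo is allowed on both sides: this is applied to the two parts of
    the logarithm of a density, of which one may have an infinite integral. *)
Lemma ge0_integral_density A (g : T -> \bar R) : measurable A ->
  measurable_fun A g -> (forall t, 0 <= g t) ->
  \int[rho]_(t in A) g t = \int[sigma]_(t in A) (g t * (p t)%:E).
Proof.
move=> mA mg g0; have rs := is_density_dominates dp.
rewrite -(Radon_Nikodym_SigmaFinite.change_of_variables rs)//.
have mf := measurable_int _ (Radon_Nikodym_SigmaFinite.f_integrable rs).
have aeA : ae_eq sigma A (EFin \o p) (Radon_Nikodym_SigmaFinite.f rho sigma).
  apply: integral_ae_eq => //; first exact: integrableS ip.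
    exact: measurable_funTS.
  move=> B _ mB; case: dp => _ _ <-//.
  by rewrite -Radon_Nikodym_SigmaFinite.f_integral.
apply/esym/ae_eq_integral => //; try (apply: emeasurable_funM => //; exact: measurable_funTS).
by apply: ae_eqe_mul2l.
Qed.

(** Two densities agree almost everywhere for [sigma], hence for [rho], so the
    divergence can be computed from any of them. *)
Lemma kullback_density : kullback rho sigma = \int[rho]_t lne (p t)%:E.
Proof.
have rs := is_density_dominates dp.
rewrite /kullback asboolT//; apply: ae_eq_integral => //.
- by apply: measurableT_comp => //; exact: measurable_lne.
- by apply: measurableT_comp => //; exact: measurable_lne.
apply: (null_dominates_ae_eq _ rs) => //.
have := @integral_ae_eq _ _ _ sigma setT measurableT (EFin \o p)
  ('d (charge_of_finite_measure rho) '/d sigma).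
move=> H; apply: (ae_eq_comp (@lne R)); apply: H => //.
  exact: Radon_Nikodym_integrable.
by move=> B _ mB; case: dp => _ _ <-//; rewrite -Radon_Nikodym_integral.
Qed.

Let f t := lne (p t)%:E.

Let mf : measurable_fun [set: T] f.
Proof. by apply: measurableT_comp => //; exact: measurable_lne. Qed.

(* p max(- ln p, 0) is at most 1, by - ln p <= 1 / p - 1; at p = 0 the value is
   (+oo) * 0 = 0. *)
Let fneg_le1 t : f^\- t * (p t)%:E <= 1.
Proof.
rewrite funenegE /f/=; case: ifPn => [pt0|].
  by rewrite (_ : p t = 0%R) ?mule0//; apply/eqP; rewrite eq_le pt0 p0.
rewrite -ltNge => pt0; rewrite -EFinN -EFin_max -EFinM lee_fin.
have [_|_] := leP (- ln (p t))%R 0%R; first by rewrite mul0r.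
have H := oppr_ln_le pt0.
apply: (@le_trans _ _ (((p t)^-1 - 1) * p t)%R); first by rewrite ler_pM2r.
by rewrite mulrBl mulVf ?gt_eqF//; lra.
Qed.

(* p - 1 <= p ln p, with the parts of the logarithm on the sides where they
   enter with a plus sign. *)
Let fposneg t : f^\- t * (p t)%:E + (p t)%:E <= f^\+ t * (p t)%:E + 1.
Proof.
rewrite funenegE funeposE /f/=; case: ifPn => [pt0|].
  have -> : p t = 0%R by apply/eqP; rewrite eq_le pt0 p0.
  by rewrite !mule0 !add0e lee_fin.
rewrite -ltNge => pt0.
rewrite -EFinN -!EFin_max -!EFinM -!EFinD lee_fin.
have := oppr_ln_le pt0; rewrite -(ler_pM2r pt0) mulrBl mulVf ?gt_eqF// => H.
have [l0|l0] := leP (ln (p t)) 0%R.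
  by rewrite max_l ?oppr_ge0//; lra.
have l1 : (- ln (p t) <= 0)%R by rewrite oppr_le0 ltW.
by rewrite (max_r l1); move: H; rewrite mulNr; lra.
Qed.

Let measurable_fnegp : measurable_fun [set: T] (fun t => f^\- t * (p t)%:E).
Proof. by apply: emeasurable_funM => //; exact: measurable_funeneg. Qed.

Let measurable_fposp : measurable_fun [set: T] (fun t => f^\+ t * (p t)%:E).
Proof. by apply: emeasurable_funM => //; exact: measurable_funepos. Qed.

(** This is what gives a meaning in the extended reals to the integral of the
    logarithm, even when the divergence is infinite. *)
Lemma kullback_neg_part : \int[rho]_t f^\- t < +oo.
Proof.
rewrite ge0_integral_density//; last exact: measurable_funeneg.
apply: (@le_lt_trans _ _ (\int[sigma]_t 1)).
  by apply: ge0_le_integral => // t _; rewrite ?mule_ge0 ?lee_fin.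
by rewrite prob_integral1 ltry.
Qed.

(** Integrating p - 1 <= p ln p against [sigma] makes the left-hand side vanish,
    since a density has integral 1. *)
Lemma kullback_density_ge0 : 0 <= \int[rho]_t f t.
Proof.
rewrite integralE sube_ge0; last first.
  by rewrite ge0_fin_numE ?kullback_neg_part ?orbT// integral_ge0.
have H : \int[rho]_t f^\- t + 1 <= \int[rho]_t f^\+ t + 1.
  rewrite ge0_integral_density//; last exact: measurable_funeneg.
  rewrite ge0_integral_density//; last exact: measurable_funepos.
  rewrite -{1}integral_density -[X in _ <= _ + X](prob_integral1 sigma).
  rewrite -ge0_integralD//; [|by move=> t _; rewrite ?mule_ge0 ?lee_fin..].
  rewrite -ge0_integralD//; [|by move=> t _; rewrite ?mule_ge0 ?lee_fin..].
  apply: ge0_le_integral => //.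
  - by move=> t _; rewrite adde_ge0 ?mule_ge0 ?lee_fin.
  - exact: emeasurable_funD.
  - exact: emeasurable_funD.
by rewrite leeD2rE in H.
Qed.

End density_facts.

Lemma kullback_ge0 rho sigma : 0 <= kullback rho sigma.
Proof.
have [rs|nrs] := pselect (rho `<< sigma); last by rewrite /kullback asboolF.
have [p dp] := is_density_exists rs.
by rewrite (kullback_density dp) (kullback_density_ge0 dp).
Qed.

End density.

(** * Change of prior *)

Section gibbs_change_of_prior.
Context d (T : measurableType d) (R : realType).
Implicit Types (rho sigma : probability T R) (h g : T -> R).

Lemma gibbs_density sigma h : bounded_measurable h ->
  is_density (gibbs sigma h) sigma
    (fun t => expR (h t) / (\int[sigma]_s expR (h s))%R)%R.
Proof.
move=> bh; have Z0 := Rintegral_expR_gt0 sigma bh.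
have [[mh hC] [me _]] := (bh, bmeas_expR bh); split.
- by apply: measurable_funM => //; exact: measurable_cst.
- by move=> t; rewrite divr_ge0 ?expR_ge0// ltW.
- by move=> A mA; rewrite gibbsE.
Qed.

Lemma gibbs_integral sigma h g : bounded_measurable h -> bounded_measurable g -> (forall t, 0 <= g t)%R ->
  \int[gibbs sigma h]_t (g t)%:E =
  ((\int[sigma]_t (g t * expR (h t)))%R / (\int[sigma]_t expR (h t))%R)%:E.
Proof.
move=> bh bg g0; have bgh := bmeasM bg (bmeas_expR bh).
rewrite (ge0_integral_density (gibbs_density sigma bh))//; last first.
  by apply/measurable_EFinP; case: bg.
set Z := (\int[sigma]_t expR (h t))%R.
under eq_integral => t _ do rewrite -EFinM mulrA mulrC.
rewrite bmeas_RintegralE; last exact/bmeasM/bgh/bmeas_cst.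
by rewrite bmeas_RintegralZl// mulrC.
Qed.

(** Tilting the reference measure by exp(h) / Z multiplies the densities by
    Z exp(-h). *)
Lemma is_density_gibbs rho sigma h p : bounded_measurable h -> is_density rho sigma p ->
  is_density rho (gibbs sigma h)
    (fun t => p t * (expR (- h t) * (\int[sigma]_s expR (h s))%R))%R.
Proof.
move=> bh [mp p0 rp]; have Z0 := Rintegral_expR_gt0 sigma bh.
set Z := (\int[sigma]_s expR (h s))%R in Z0 *.
have [mk _] := bmeasM (bmeas_expR (bmeasN bh)) (bmeas_cst T Z).
have k0 t : (0 <= p t * (expR (- h t) * Z))%R.
  by rewrite mulr_ge0 ?p0 ?mulr_ge0 ?expR_ge0 ?(ltW Z0).
have mpk : measurable_fun [set: T] (fun t => p t * (expR (- h t) * Z))%R.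
  exact: measurable_funM.
split => // A mA.
rewrite (ge0_integral_density (gibbs_density sigma bh))//; last first.
  by apply/measurable_funTS/measurable_EFinP.
rewrite rp//; apply: eq_integral => t _; rewrite -EFinM; congr EFin.
rewrite -/Z expRN; field.
by rewrite gt_eqF//= gt_eqF ?expR_gt0.
Qed.

(** Additivity when the integral of [f] may be +oo. If [f] is not integrable then
    neither is its sum with a bounded function, and both integrals are +oo as
    their negative parts are finite. *)
Lemma integralD_bmeas rho (f : T -> \bar R) g :
  measurable_fun [set: T] f -> bounded_measurable g ->
  \int[rho]_t f^\- t < +oo ->
  \int[rho]_t (fun s => f s + (g s)%:E)^\- t < +oo ->
  \int[rho]_t (f t + (g t)%:E) = \int[rho]_t f t + (\int[rho]_t g t)%R%:E.
Proof.
move=> mf bg fn fgn; have ig := bmeas_integrable rho bg.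
have mg : measurable_fun [set: T] (EFin \o g) by case/integrableP: ig.
have infty (k : T -> \bar R) : measurable_fun [set: T] k ->
    \int[rho]_t k^\- t < +oo -> ~ rho.-integrable [set: T] k ->
    \int[rho]_t k t = +oo.
  move=> mk kn nk; have kn0 : 0 <= \int[rho]_t k^\- t by exact: integral_ge0.
  have : \int[rho]_t k^\+ t = +oo.
    apply/eqP; rewrite eq_le leey/= leNgt; apply/negP => kp; apply: nk.
    apply/integrableP; split => //.
    rewrite -[X in \int[_]_(x in _) X x]/(abse \o k) fune_abse.
    rewrite ge0_integralD//; [exact: lte_add_pinfty| |].
      exact: measurable_funepos.
    exact: measurable_funeneg.
  move=> kp; rewrite integralE kp addye// eqe_oppLR/=.
  by rewrite (lt_eqF kn).
have [fi|nfi] := pselect (rho.-integrable [set: T] f).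
  by rewrite integralD// [X in _ + X = _]bmeas_RintegralE.
have fgoo : \int[rho]_t (f t + (g t)%:E) = +oo.
  apply: infty => //; first exact: emeasurable_funD.
  move=> fgi; apply: nfi.
  have -> : f = (fun t => f t + (g t)%:E) \- (EFin \o g).
    by apply/funext => t /=; rewrite addeK.
  exact: integrableB.
by rewrite fgoo (infty f).
Qed.

(** The logarithm of the density of [rho] changes by the bounded function
    ln pi(exp h) - h. The tilted measure and [sigma] have the same null sets, so
    the identity also holds, as +oo = +oo, when [rho] is not dominated. *)
Lemma kullback_gibbs rho sigma h : bounded_measurable h ->
  kullback rho (gibbs sigma h) = kullback rho sigma +
    (ln (\int[sigma]_t expR (h t))%R - (\int[rho]_t h t)%R)%:E.
Proof.
move=> bh; have [rs|nrs] := pselect (rho `<< sigma); last first.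
  rewrite /kullback !asboolF// => H; apply: nrs; apply: null_dominates_trans H _.
  exact: is_density_dominates (gibbs_density sigma bh).
have [p dp] := is_density_exists rs; have dq := is_density_gibbs bh dp.
have Z0 := Rintegral_expR_gt0 sigma bh.
have lneE t : lne (p t * (expR (- h t) * (\int[sigma]_s expR (h s))))%:E =
    lne (p t)%:E + (ln (\int[sigma]_t expR (h t)) - h t)%:E.
  have k0 : (0 < expR (- h t) * (\int[sigma]_s expR (h s)))%R.
    by rewrite mulr_gt0 ?expR_gt0.
  rewrite /= pmulr_lle0//; case: ifPn => // pt; rewrite -ltNge in pt.
  by rewrite !lnM ?posrE ?expR_gt0// expRK -EFinD; congr EFin; ring.
have bk : bounded_measurable (fun t => ln (\int[sigma]_t expR (h t)) - h t)%R.
  exact/bmeasB/bh/bmeas_cst.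
have np := kullback_neg_part dp; have := kullback_neg_part dq.
rewrite (kullback_density dp) (kullback_density dq).
rewrite (_ : (fun t => lne (p t * _)%:E) = fun t => lne (p t)%:E +
    (ln (\int[sigma]_t expR (h t)) - h t)%:E); last exact/funext/lneE.
move=> nq; rewrite integralD_bmeas//; last first.
  apply: measurableT_comp; first exact: measurable_lne.
  by apply/measurable_EFinP; case: dp.
by rewrite bmeas_RintegralB ?prob_Rintegral_cst//; exact: bmeas_cst.
Qed.

(** Nonnegativity of the divergence from the measure tilted by [h]. *)
Lemma donsker_varadhan rho sigma h : bounded_measurable h ->
  (\int[rho]_t h t)%R%:E <=
  kullback rho sigma + (ln (\int[sigma]_t expR (h t))%R)%:E.
Proof.
move=> bh; have := kullback_ge0 rho (gibbs sigma h).
rewrite kullback_gibbs// EFinB addeA sube_ge0//.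
Qed.

End gibbs_change_of_prior.

(** * Product expectations and an integrated Markov inequality *)

Section product_expectation.
Context d (T : measurableType d) (R : realType).

(** Independence of the coordinates, peeling off one factor at a time by
    Tonelli. *)
Lemma integral_prod_prob n (P : 'I_n -> probability T R) (g : 'I_n -> T -> R) :
  (forall i, bounded_measurable (g i)) -> (forall i z, 0 <= g i z)%R ->
  \int[prod_prob P]_w (\prod_(i < n) g i (tnth w i))%:E =
  (\prod_(i < n) \int[P i]_z g i z)%R%:E.
Proof.
elim: n P g => [|n IH] P g bg g0.
  by under eq_integral do rewrite big_ord0; rewrite big_ord0 prob_integral1.
have mprod k (h : 'I_k -> T -> R) : (forall i, bounded_measurable (h i)) ->
    measurable_fun [set: k.-tuple T] (fun w => (\prod_(i < k) h i (tnth w i))%:E).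
  move=> bh; apply/measurable_EFinP/measurable_prod => i _.
  by apply: (measurableT_comp (f := h i)); [case: (bh i)|exact: measurable_tnth].
pose g' i := g (lift ord0 i).
rewrite big_ord_recl /= ge0_integral_distribution//; last 2 first.
- exact: mprod.
- by move=> w; rewrite lee_fin prodr_ge0.
transitivity (\int[P ord0 \x prod_prob (fun i => P (lift ord0 i))]_p
  ((g ord0 p.1)%:E * (\prod_(i < n) g' i (tnth p.2 i))%:E)).
  apply: eq_integral => -[z w] _ /=; rewrite big_ord_recl -EFinM.
  by congr (_ * _)%:E; apply: eq_bigr => i _; rewrite /cons_pair/= tnthS.
rewrite fubini_tonelli1//=; last 2 first.
- apply: emeasurable_funM.
    apply/measurable_EFinP/(measurableT_comp (f := g ord0)) => //.
    by case: (bg ord0).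
  exact: (measurableT_comp (mprod _ g' (fun i => bg _))).
- by move=> p; rewrite mule_ge0 ?lee_fin ?g0// prodr_ge0// => i _; exact: g0.
under eq_integral => z _.
  rewrite /fubini_F/=; have -> : \int[prod_prob (fun i => P (lift ord0 i))]_w
      ((g ord0 z)%:E * (\prod_(i < n) g' i (tnth w i))%:E) =
      ((\prod_(i < n) \int[P (lift ord0 i)]_x g' i x)%R * g ord0 z)%:E.
    rewrite ge0_integralZl//; last 3 first.
    - exact: (mprod _ g' (fun i => bg _)).
    - by move=> w _; rewrite lee_fin prodr_ge0// => i _; exact: g0.
    - by rewrite lee_fin g0.
    - by rewrite (IH _ g' (fun i => bg _) (fun i => g0 _)) muleC.
  over.
rewrite bmeas_RintegralE; last exact/bmeasM/(bg ord0)/bmeas_cst.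
by rewrite bmeas_RintegralZl// mulrC.
Qed.

Lemma prod_prob_tnth n (P : 'I_n -> probability T R) i (B : set T) :
  measurable B -> prod_prob P [set w | B (tnth w i)] = P i B.
Proof.
move=> mB; pose A j := if j == i then B else setT.
have mA j : measurable (A j) by rewrite /A; case: ifPn.
have := prod_prob_box P mA; rewrite (bigD1 i)//= big1 ?mule1; last first.
  by move=> j ji; rewrite /A (negbTE ji) [LHS](@probability_setT _ _ _ (P j)).
rewrite {2}/A eqxx => <-; congr (prod_prob P _); apply/seteqP; split => w /=.
  by move=> Bw j; rewrite /A; case: eqP => [->|].
by move=> /(_ i); rewrite /A eqxx.
Qed.

(** Fubini makes the prior average of [G] a random variable of mean at most 1,
    to which Markov's inequality applies. The exceptional event does not depend
    on a posterior, which is the source of uniformity. *)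
Lemma markov_prior d' (U : measurableType d') (pi : probability T R)
    (Q : probability U R) (G : T * U -> \bar R) (eps : R) :
  (0 < eps)%R -> measurable_fun [set: T * U] G -> (forall p, 0 <= G p) ->
  \int[pi]_t \int[Q]_w G (t, w) <= 1 ->
  exists A : set U, [/\ measurable A, (1 - eps)%:E <= Q A &
    forall w, A w -> \int[pi]_t G (t, w) <= (eps^-1)%:E].
Proof.
move=> eps0 mG G0 IG; pose F w := \int[pi]_t G (t, w).
have mF : measurable_fun [set: U] F by exact: measurable_fun_fubini_tonelli_G.
have F0 w : 0 <= F w by exact: integral_ge0.
pose B := [set w | (eps^-1)%:E <= F w].
have mB : measurable B.
  by rewrite -[B]setTI; exact: emeasurable_fun_c_infty.
have QB : Q B <= eps%:E.
  have := @le_integral_abse _ _ _ Q setT measurableT F (eps^-1)%R mF.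
  rewrite invr_gt0 => /(_ eps0).
  under [X in _ <= X -> _]eq_integral do rewrite gee0_abs//.
  rewrite setTI (_ : [set _ | _] = B); last first.
    by apply/seteqP; split => w; rewrite /B/= gee0_abs.
  rewrite /F -fubini_tonelli// => /le_trans/(_ IG).
  by rewrite -(@lee_pmul2l _ eps%:E)// muleA -EFinM divff ?gt_eqF// mul1e mule1.
exists (~` B); split; first exact: measurableC.
- rewrite probability_setC// EFinB leeB//.
- by move=> w /= /negP; rewrite -ltNge => /ltW.
Qed.

End product_expectation.

(** * Moments of the empirical risk *)

Section risk_moments.
Local Open Scope ring_scope.
Context (R : realType) (N : nat) (dX dY dTheta : measure_display).
Context (X : measurableType dX) (Y : measurableType dY).
Context (Theta : measurableType dTheta).
Hypothesis N_ge1 : (1 <= N)%N.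
Hypothesis finY : finite_set [set: Y].
Hypothesis discreteY : forall B : set Y, measurable B.
Variables (P : 'I_N -> probability (X * Y)%type R) (f : Theta -> X -> Y).
Hypothesis mf : measurable_fun [set: Theta * X] (fun p : Theta * X => f p.1 p.2).

Local Notation Omega := (N.-tuple (X * Y)).
Local Notation r := (@emp_risk _ _ _ Theta X Y R N f).
Local Notation risk := (@exp_risk _ _ _ Theta X Y R N f (prod_prob P)).

Let N_neq0 : N%:R != 0 :> R. Proof. by rewrite pnatr_eq0 -lt0n. Qed.

Let err (t : Theta) (z : X * Y) : R := (f t z.1 != z.2)%:R.

(* p_i(theta), the probability of an error on the i-th example. *)
Let p_ (t : Theta) (i : 'I_N) : R := \int[P i]_z err t z.

(** The diagonal of a finite discrete space is a finite union of measurable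
    rectangles. *)
Lemma measurable_error :
  measurable [set q : Theta * (X * Y) | f q.1 q.2.1 != q.2.2].
Proof.
have mf1 : measurable_fun [set: Theta * (X * Y)] (fun q => f q.1 q.2.1).
  apply: (measurableT_comp mf (g := fun q => (q.1, q.2.1))).
  by apply: measurable_fun_pair => //; exact: measurableT_comp.
have m2 : measurable_fun [set: Theta * (X * Y)] (fun q => q.2.2).
  exact: measurableT_comp.
rewrite (_ : [set _ | _] = ~` \bigcup_(y in [set: Y])
    ((fun q : Theta * (X * Y) => f q.1 q.2.1) @^-1` [set y] `&`
     (fun q : Theta * (X * Y) => q.2.2) @^-1` [set y])); last first.
  apply/seteqP; split => q /=.
    by move=> /eqP fq [y _ /= [fy y2]]; apply: fq; rewrite fy y2.
  by move=> H; apply/eqP => fq; apply: H; exists q.2.2.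
apply/measurableC/fin_bigcup_measurable => // y _; apply: measurableI.
  by rewrite -[X in measurable X]setTI; exact: mf1.
by rewrite -[X in measurable X]setTI; exact: m2.
Qed.

Let measurable_err : measurable_fun [set: Theta * (X * Y)] (fun q => err q.1 q.2).
Proof.
rewrite /err (_ : (fun _ => _) =
    \1_[set q : Theta * (X * Y) | f q.1 q.2.1 != q.2.2]).
  by apply: measurable_indic; exact: measurable_error.
by apply/funext => q; rewrite indicE; congr (nat_of_bool _)%:R; apply/idP/idP; rewrite in_setE.
Qed.

Let err_ge0 t z : 0 <= err t z. Proof. exact: ler0n. Qed.

Let err_le1 t z : err t z <= 1. Proof. by rewrite /err; case: (_ != _). Qed.

Let bmeas_err t : bounded_measurable (err t).
Proof.
split; first exact: (measurableT_comp measurable_err (pair1_measurable t)).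
by exists 1 => z; rewrite ger0_norm.
Qed.

Lemma measurable_emp_risk :
  measurable_fun [set: Theta * Omega] (fun p => r p.2 p.1).
Proof.
apply: measurable_funM => //; apply: measurable_sum => i.
apply: (measurableT_comp measurable_err (g := fun p => (p.1, tnth p.2 i))).
apply: measurable_fun_pair => //.
exact: (measurableT_comp (@measurable_tnth _ _ N i)).
Qed.

Let mean_itv (F : 'I_N -> R) : (forall i, 0 <= F i <= 1) ->
  0 <= N%:R^-1 * \sum_(i < N) F i <= 1.
Proof.
move=> F01; rewrite mulr_ge0 ?invr_ge0 ?sumr_ge0//=; last first.
  by move=> i _; case/andP: (F01 i).
rewrite ler_pdivrMl ?ltr0n// mulr1.
rewrite (le_trans (ler_sum _ (fun i _ => proj2 (andP (F01 i)))))//.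
by rewrite sumr_const card_ord.
Qed.

Lemma emp_risk_itv w t : 0 <= r w t <= 1.
Proof. by apply: mean_itv => i; rewrite err_ge0 err_le1. Qed.

Lemma bmeas_emp_risk w : bounded_measurable (r w).
Proof.
split; last by exists 1 => t; case/andP: (emp_risk_itv w t) => *; rewrite ger0_norm.
exact: (measurableT_comp measurable_emp_risk (pair2_measurable w)).
Qed.

(* The i-th coordinate of the product measure has law P i. *)
Let exp_riskE t : risk t = N%:R^-1 * \sum_(i < N) p_ t i.
Proof.
congr (_ * _); apply: eq_bigr => i _; pose B := [set z : X * Y | f t z.1 != z.2].
have mB : measurable B.
  rewrite (_ : B = xsection
      [set q : Theta * (X * Y) | f q.1 q.2.1 != q.2.2] t); last first.
    by apply/funext => z; apply/propext; apply: iff_sym; exact: xsectionP.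
  exact: measurable_xsection measurable_error.
rewrite (prod_prob_tnth _ _ mB) /p_ /Rintegral -[in LHS](setIT B).
rewrite -integral_indic//; congr fine; apply: eq_integral => z _; congr EFin.
by rewrite indicE; congr (nat_of_bool _)%:R; apply/idP/idP; rewrite in_setE.
Qed.

Let p_itv t i : 0 <= p_ t i <= 1.
Proof.
rewrite Rintegral_ge0//= -[leRHS](prob_Rintegral_cst (P i)).
exact/bmeas_le_Rintegral/err_le1/bmeas_cst.
Qed.

Lemma exp_risk_itv t : 0 <= risk t <= 1.
Proof. by rewrite exp_riskE; exact: mean_itv. Qed.

Lemma bmeas_exp_risk : bounded_measurable risk.
Proof.
split; last by exists 1 => t; case/andP: (exp_risk_itv t) => *; rewrite ger0_norm.
rewrite (_ : risk = fun t => N%:R^-1 * \sum_(i < N) p_ t i); last exact/funext/exp_riskE.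
apply: measurable_funM => //; apply: measurable_sum => i.
apply/measurable_EFinP; rewrite (_ : EFin \o _ = fubini_F (P i)
    (EFin \o (fun q => err q.1 q.2))).
  apply: measurable_fun_fubini_tonelli_F; first exact/measurable_EFinP.
  by move=> q; rewrite lee_fin.
by apply/funext => t; rewrite /= /p_ -bmeas_RintegralE.
Qed.

(** This makes ln (1 + c * R) meaningful for all the constants c of interest. *)
Lemma exp_risk_affine_gt0 (c : R) t : -1 < c -> 0 < 1 + c * risk t.
Proof. by move=> c1; have /andP[r0 r1] := exp_risk_itv t; case: (leP 0 c) => ?; nra. Qed.

(** The exponential is the product of the independent factors
    1 + c 1[error on the i-th example], because (1 + c)^e = 1 + c e for e in
    {0, 1}; the means 1 + c p_i of the factors have arithmetic mean 1 + c R. *)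
Lemma emp_risk_moment (c : R) t : -1 < c ->
  (\int[prod_prob P]_w (expR (N%:R * ln (1 + c) * r w t))%:E
    <= (expR (N%:R * ln (1 + c * risk t)))%:E)%E.
Proof.
move=> c1; have c0 : 0 < 1 + c by lra.
pose g (i : 'I_N) z := 1 + c * err t z.
have bg i : bounded_measurable (g i).
  exact/bmeasD/bmeasM/bmeas_err/bmeas_cst/bmeas_cst.
have g0 i z : 0 <= g i z.
  by have := err_ge0 t z; have := err_le1 t z; rewrite /g; case: (leP 0 c) => ?; nra.
have -> : (\int[prod_prob P]_w (expR (N%:R * ln (1 + c) * r w t))%:E =
    \int[prod_prob P]_w (\prod_(i < N) g i (tnth w i))%:E)%E.
  apply: eq_integral => w _; congr EFin.
  rewrite mulrACA [X in expR X](_ : _ = \sum_(i < N) ln (1 + c) * err t (tnth w i)).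
    rewrite expR_sum; apply: eq_bigr => i _; rewrite /g /err.
    by case: (_ != _); rewrite ?mulr1 ?lnK ?posrE// !mulr0 addr0 expR0.
  by rewrite -mulr_sumr mulfV// mul1r.
rewrite integral_prod_prob// lee_fin.
have intg i : \int[P i]_z g i z = 1 + c * p_ t i.
  rewrite bmeas_RintegralD; [|exact: bmeas_cst|exact/bmeasM/bmeas_err/bmeas_cst].
  by rewrite prob_Rintegral_cst bmeas_RintegralZl.
have intg0 i : 0 <= \int[P i]_z g i z by exact: Rintegral_ge0.
have /= := (leif_AGM (A := [pred i : 'I_N | true]) (fun i _ => intg0 i)).1.
rewrite card_ord => /le_trans; apply.
rewrite (_ : _ / _ = 1 + c * risk t); last first.
  under eq_bigr do rewrite intg.
  rewrite big_split/= sumr_const card_ord -mulr_sumr exp_riskE.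
  by field.
by rewrite expRM_natl lnK// posrE exp_risk_affine_gt0.
Qed.

End risk_moments.

(** * Thermodynamic integration *)

Section thermodynamic_integration.
Local Open Scope ring_scope.
Context d (T : measurableType d) (R : realType).
Variables (pi : probability T R) (r : T -> R).
Hypothesis br : bounded_measurable r.

Let bmeas_weight (g : T -> R) (x : R) : bounded_measurable g ->
  bounded_measurable (fun t => g t * expR (- (x * r t))).
Proof. by move=> bg; exact/bmeasM/bmeas_expR/bmeasN/bmeasM/br/bmeas_cst. Qed.

(** Differentiation under the integral sign. With g = 1 it gives the derivative of
    the Laplace transform of [r]; with g = r, the continuity of that
    derivative. *)
Lemma is_derive_laplace (g : T -> R) (x : R) : bounded_measurable g ->
  is_derive x 1 (fun y : R => \int[pi]_t (g t * expR (- (y * r t))))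
    (- \int[pi]_t (g t * r t * expR (- (x * r t)))).
Proof.
move=> bg; pose F (y : R) (t : T) : R := g t * expR (- (y * r t)).
have dF (y : R) t : is_derive y (1 : R) (F ^~ t) (- (g t * r t * expR (- (y * r t)))).
  apply: is_derive_eq.
  by rewrite /GRing.scale/=; ring.
have [_ [C hC]] := br; have [_ [D hD]] := bg.
have C0 : 0 <= C by apply: le_trans (hC point).
have D0 : 0 <= D by apply: le_trans (hD point).
pose I := `](x - 1), (x + 1)[%classic : set R.
have Ix : I x by rewrite /I/= in_itv/=; lra.
pose G (t : T) := D * C * expR ((`|x| + 1) * C).
have intF y : I y -> pi.-integrable setT (EFin \o F y).
  by move=> _; exact/bmeas_integrable/bmeas_weight.
have G0 t : 0 <= G t by rewrite !mulr_ge0 ?expR_ge0.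
have intG : pi.-integrable setT (EFin \o G) by exact/bmeas_integrable/bmeas_cst.
have derF y t : I y -> setT t -> derivable (F ^~ t) y 1.
  by move=> _ _; have [] := dF y t.
have d1E y t : partial1of2 F y t = - (g t * r t * expR (- (y * r t))).
  by rewrite partial1of2E; have [_ ->] := dF y t.
have GF y t : I y -> setT t -> `|partial1of2 F y t| <= G t.
  rewrite /I/= in_itv/= => /andP[y1 y2] _; rewrite d1E normrN !normrM.
  rewrite ler_pM ?mulr_ge0//; first by rewrite ler_pM.
  rewrite ger0_norm ?expR_ge0// ler_expR (le_trans (ler_norm _))//.
  rewrite normrN normrM ler_pM// ler_norml.
  by have := ler_norm x; have := ler_norm (- x); rewrite normrN; lra.
apply: DeriveDef.
  exact: (derivable_under_integral measurableT Ix intF derF G0 intG GF).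
rewrite -derive1E.
rewrite (differentiation_under_integral measurableT Ix intF derF G0 intG GF).
under eq_Rintegral do rewrite d1E -mulN1r.
by rewrite bmeas_RintegralZl ?mulN1r//; exact/bmeas_weight/bmeasM.
Qed.

(** The mean of [r] under the tilted measure is the derivative of
    - ln pi(exp(- x r)), so this is the fundamental theorem of calculus. *)
Lemma integral_gibbs_mean (a b : R) : a < b -> (forall t, 0 <= r t) ->
  (\int[lebesgue_measure]_(x in `[a, b])
     \int[gibbs pi (fun t => - (x * r t))%R]_t (r t)%:E =
  (ln (\int[pi]_t expR (- (a * r t)))%R - ln (\int[pi]_t expR (- (b * r t)))%R)%:E)%E.
Proof.
move=> ab r0; pose Z x := \int[pi]_t (1 * expR (- (x * r t))).
pose M x := \int[pi]_t (r t * expR (- (x * r t))).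
have b1 : bounded_measurable (fun _ : T => 1 : R) by exact: bmeas_cst.
have bh x : bounded_measurable (fun t => - (x * r t)) by exact/bmeasN/bmeasM/br/bmeas_cst.
have ZE x : \int[pi]_t expR (- (x * r t)) = Z x.
  by apply: eq_Rintegral => t _; rewrite mul1r.
have Z0 x : 0 < Z x by rewrite -ZE; exact: Rintegral_expR_gt0.
have dZ (x : R) : is_derive x (1 : R) Z (- M x).
  have := is_derive_laplace x b1.
  by under [X in is_derive _ _ _ (- X)]eq_Rintegral do rewrite mul1r.
have dL (x : R) : is_derive x (1 : R) (fun y => - ln (Z y)) (M x / Z x).
  have := is_derive1_ln (Z0 x) => dl.
  apply: is_derive_eq.
  by rewrite /GRing.scale/=; ring.
have cM : continuous (fun x => M x / Z x).
  move=> x; apply: cvgM.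
    have [dM _] := is_derive_laplace x br.
    exact/differentiable_continuous/derivable1_diffP.
  apply: cvgV; first by rewrite gt_eqF.
  by have [dZx _] := dZ x; exact/differentiable_continuous/derivable1_diffP.
have cL : continuous (fun y => - ln (Z y)).
  by move=> x; have [dLx _] := dL x; exact/differentiable_continuous/derivable1_diffP.
under eq_integral => x _ do rewrite gibbs_integral// ZE -[X in X / _]/(M x).
rewrite (continuous_FTC2 (F := fun y => - ln (Z y)) ab).
- by rewrite !ZE -EFinB opprK addrC.
- exact: continuous_subspaceT.
- split=> [x _||]; first by have [] := dL x.
    exact/cvg_at_right_filter/cL.
  exact/cvg_at_left_filter/cL.
- by move=> x _; rewrite derive1E; have [_ ->] := dL x.
Qed.

End thermodynamic_integration.

(** * The quadratic root and its Jensen inequality *)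

Section deterministic.
Local Open Scope ring_scope.
Context d (T : measurableType d) (R : realType).

(** The right-hand side is the nonnegative root of
    (1 - alpha y)(1 + gamma y) = e, and the quadratic decreases on the
    nonnegative reals. *)
Lemma quadratic_root_ge (alpha gamma x e : R) :
  0 < gamma -> gamma < alpha -> 0 <= x ->
  e <= (1 - alpha * x) * (1 + gamma * x) ->
  x <= (alpha - gamma) / (2 * alpha * gamma) *
    (Num.sqrt (1 + 4 * alpha * gamma / (alpha - gamma) ^+ 2 * (1 - e)) - 1).
Proof.
move=> g0 ga x0 ex; set dl := alpha - gamma.
have d0 : 0 < dl by rewrite subr_gt0.
have a0 : 0 < alpha := lt_trans g0 ga.
have c0 : 0 < alpha * gamma by exact: mulr_gt0.
have [dn an gn] : [/\ dl != 0, alpha != 0 & gamma != 0] by rewrite !gt_eqF.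
have -> : x = dl / (2 * alpha * gamma) * ((1 + 2 * alpha * gamma * x / dl) - 1).
  by field; rewrite ?dn ?an ?gn.
rewrite ler_pM2l; last by rewrite divr_gt0// -mulrA mulr_gt0.
rewrite lerD2r -[leLHS]ger0_norm; last first.
  by rewrite addr_ge0// divr_ge0 ?(ltW d0)// mulr_ge0// -mulrA mulr_ge0// ltW.
rewrite -sqrtr_sqr ler_wsqrtr//.
have -> : (1 + 2 * alpha * gamma * x / dl) ^+ 2 =
    1 + 4 * alpha * gamma / dl ^+ 2 * (dl * x + alpha * gamma * x ^+ 2).
  by field; rewrite ?dn ?an ?gn.
rewrite lerD2l ler_pM2l; first by rewrite /dl; nra.
by rewrite divr_gt0 ?exprn_gt0// -mulrA mulr_gt0.
Qed.

(** Here e = exp(- (alpha - gamma) m) >= 1 - (alpha - gamma) m, so that [m] is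
    beyond the nonnegative root. *)
Lemma quadratic_root_le (alpha gamma m : R) :
  0 < gamma -> gamma < alpha -> 0 <= m ->
  (alpha - gamma) / (2 * alpha * gamma) *
    (Num.sqrt (1 + 4 * alpha * gamma / (alpha - gamma) ^+ 2 *
       (1 - expR (- ((alpha - gamma) * m)))) - 1) <= m.
Proof.
move=> g0 ga m0; set dl := alpha - gamma.
have d0 : 0 < dl by rewrite subr_gt0.
have a0 : 0 < alpha := lt_trans g0 ga.
have c0 : 0 < alpha * gamma by exact: mulr_gt0.
have [dn an gn] : [/\ dl != 0, alpha != 0 & gamma != 0] by rewrite !gt_eqF.
have -> : m = dl / (2 * alpha * gamma) * ((1 + 2 * alpha * gamma * m / dl) - 1).
  by field; rewrite ?dn ?an ?gn.
rewrite -[X in expR (- (_ * X))](_ : m = _); last first.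
  by field; rewrite ?dn ?an ?gn.
rewrite ler_pM2l; last by rewrite divr_gt0// -mulrA mulr_gt0.
rewrite lerD2r -[leRHS]ger0_norm; last first.
  by rewrite addr_ge0// divr_ge0 ?(ltW d0)// mulr_ge0// -mulrA mulr_ge0// ltW.
rewrite -sqrtr_sqr ler_wsqrtr//.
have -> : (1 + 2 * alpha * gamma * m / dl) ^+ 2 =
    1 + 4 * alpha * gamma / dl ^+ 2 * (dl * m + alpha * gamma * m ^+ 2).
  by field; rewrite ?dn ?an ?gn.
rewrite lerD2l ler_pM2l; last first.
  by rewrite divr_gt0 ?exprn_gt0// -mulrA mulr_gt0.
have := expR_ge1Dx (- (dl * m)); have := sqr_ge0 m; nra.
Qed.

Lemma bmeas_ln_affine (g : T -> R) (c : R) : -1 < c -> bounded_measurable g ->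
  (forall t, 0 <= g t <= 1) -> bounded_measurable (fun t => ln (1 + c * g t)).
Proof.
move=> c1 bg g01; apply: (@bmeas_ln _ _ _ _ (Num.min 1 (1 + c))).
- by rewrite lt_min ltr01/=; lra.
- move=> t; rewrite ge_min; have /andP[? ?] := g01 t.
  by case: (leP 0 c) => ?; apply/orP; [left|right]; nra.
- exact/bmeasD/bmeasM/bg/bmeas_cst/bmeas_cst.
Qed.

(** Jensen's inequality for ln q, where q(y) = (1 - alpha y)(1 + gamma y). As ln q
    is bounded above by its tangent at the mean of [g], integrating the tangent
    is enough. *)
Lemma jensen_ln_quadratic (rho : probability T R) (g : T -> R) (alpha gamma : R) :
  0 < gamma -> 0 < alpha -> alpha < 1 -> bounded_measurable g -> (forall t, 0 <= g t <= 1) ->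
  \int[rho]_t (ln (1 - alpha * g t) + ln (1 + gamma * g t)) <=
  ln ((1 - alpha * \int[rho]_t g t) * (1 + gamma * \int[rho]_t g t)).
Proof.
move=> g0 a0 a1 bg g01; set x := \int[rho]_t g t.
have x01 : 0 <= x <= 1.
  rewrite Rintegral_ge0; last by move=> t _; case/andP: (g01 t).
  rewrite -[leRHS](prob_Rintegral_cst rho).
  by apply: bmeas_le_Rintegral => //; [exact: bmeas_cst|move=> t; case/andP: (g01 t)].
pose q (y : R) := (1 - alpha * y) * (1 + gamma * y).
have q0 y : 0 <= y <= 1 -> 0 < 1 - alpha * y /\ 0 < 1 + gamma * y.
  by move=> /andP[y0 y1]; split; nra.
have [qx1 qx2] := q0 _ x01; have qx : 0 < q x by exact: mulr_gt0.
pose B := (gamma - alpha - 2 * alpha * gamma * x) / q x.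
have bB : bounded_measurable (fun t => B * g t) by exact/bmeasM/bg/bmeas_cst.
have bl : bounded_measurable (fun t => ln (1 - alpha * g t) + ln (1 + gamma * g t)).
  apply: bmeasD; last by apply: bmeas_ln_affine => //; lra.
  under [X in bounded_measurable X]eq_fun do rewrite -mulNr.
  by apply: bmeas_ln_affine => //; lra.
(* B is q'(x) / q(x). From ln z <= z - 1 at z = q(y) / q(x), the tangent
   bound holds, with the slack alpha gamma (y - x)^2 / q(x). *)
have tangent t : ln (1 - alpha * g t) + ln (1 + gamma * g t) <=
    (ln (q x) - B * x) + B * g t.
  have [qt1 qt2] := q0 _ (g01 t); rewrite -lnM ?posrE//.
  have qt : 0 < q (g t) by exact: mulr_gt0.
  have -> : (1 - alpha * g t) * (1 + gamma * g t) = q x * (q (g t) / q x).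
    by rewrite mulrCA divff ?mulr1// gt_eqF.
  rewrite lnM ?posrE ?divr_gt0//.
  have lnq : ln (q (g t) / q x) <= q (g t) / q x - 1.
    have := @le_ln1Dx R (q (g t) / q x - 1); rewrite (addrC 1) subrK; apply.
    have : 0 < q (g t) / q x by exact: divr_gt0.
    lra.
  rewrite -addrA lerD2l (le_trans lnq)//.
  have -> : q (g t) / q x - 1 =
      - (B * x) + B * g t - alpha * gamma * (g t - x) ^+ 2 / q x.
    by rewrite /B /q; field; rewrite !gt_eqF.
  by rewrite gerBl divr_ge0 ?(ltW qx)// mulr_ge0 ?sqr_ge0// mulr_ge0 ?ltW.
apply: (le_trans (bmeas_le_Rintegral _ bl _ tangent)).
  exact/bmeasD/bB/bmeas_cst.
rewrite bmeas_RintegralD//; last exact: bmeas_cst.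
by rewrite prob_Rintegral_cst bmeas_RintegralZl// -/x subrK.
Qed.

End deterministic.

(** * The variational inequality and its event *)

(** By the arithmetic-geometric mean inequality, W V <= (Za / eps)^2; the lower
    bound of [V] then cancels [Za]. *)
Lemma ln_le_of_two_weights (R : realType) (Za Zb W V eps : R) :
  (0 < Za -> 0 < Zb -> 0 < W -> 0 < eps ->
   W + V <= 2 * Za / eps -> Za ^+ 2 / Zb <= V ->
   ln W <= ln Zb - 2 * ln eps)%R.
Proof.
move=> Za0 Zb0 W0 e0 WV CS.
have V0 : (0 <= V)%R by rewrite (le_trans _ CS)// divr_ge0 ?sqr_ge0// ltW.
have AG : (W * V <= (Za / eps) ^+ 2)%R.
  have : ((W + V) ^+ 2 <= (2 * Za / eps) ^+ 2)%R.
    have Ze0 : (0 <= 2 * Za / eps)%R by rewrite divr_ge0 ?mulr_ge0 ?ltW.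
    by apply: lerXn2r => //; rewrite nnegrE addr_ge0// ltW.
  by have := sqr_ge0 (W - V); rewrite -mulrA; nra.
have WZ : (W <= Zb / eps ^+ 2)%R.
  have := le_trans (ler_wpM2l (ltW W0) CS) AG.
  have -> : (W * (Za ^+ 2 / Zb) = W / Zb * Za ^+ 2)%R by ring.
  rewrite expr_div_n [leRHS]mulrC ler_pM2r ?exprn_gt0//.
  by rewrite ler_pdivrMr// mulrC.
have -> : (ln Zb - 2 * ln eps = ln (Zb / eps ^+ 2))%R.
  rewrite lnM ?posrE ?invr_gt0 ?exprn_gt0// lnV ?posrE ?exprn_gt0//.
  by rewrite lnXn// mulr_natl.
by rewrite ler_ln ?posrE// divr_gt0// exprn_gt0.
Qed.

(** Up to the factor 1 / pi(exp a), the hypothesis bounds the sum of two means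
    under pi_exp(a): that of exp(u), to which Donsker-Varadhan applies, and that
    of exp(a - b), which controls the ratio of the normalising constants of
    pi_exp(a) and pi_exp(b). The function [a] is not observable and has been
    eliminated from the divergence in the conclusion. *)
Lemma two_weight_variational d (T : measurableType d) (R : realType)
    (pi rho : probability T R) (a b u : T -> R) (eps : R) :
  bounded_measurable a -> bounded_measurable b -> bounded_measurable u -> (0 < eps)%R ->
  (\int[pi]_t (expR (a t + u t) + expR (a t + a t - b t)) <=
     2 * \int[pi]_t expR (a t) / eps)%R ->
  (\int[rho]_t (a t + u t - b t))%R%:E <=
  kullback rho (gibbs pi b) - (2 * ln eps)%:E.
Proof.
move=> ba bb bu e0 H; have bau := bmeasD ba bu.
have baab := bmeasB (bmeasD ba ba) bb.
set Za := (\int[pi]_t expR (a t))%R in H; pose Zb := (\int[pi]_t expR (b t))%R.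
pose W := (\int[pi]_t expR (a t + u t))%R.
pose V := (\int[pi]_t expR (a t + a t - b t))%R.
have Za0 : (0 < Za)%R by exact: Rintegral_expR_gt0.
have Zb0 : (0 < Zb)%R by exact: Rintegral_expR_gt0.
have W0 : (0 < W)%R by exact: Rintegral_expR_gt0.
have WV : (W + V <= 2 * Za / eps)%R.
  by move: H; rewrite bmeas_RintegralD//; exact: bmeas_expR.
(* Cauchy-Schwarz, since exp(a) is the square root of exp(b) exp(2a - b);
   s minimises the integral of (exp(a) - s exp(b))^2 exp(-b). *)
have CS : (Za ^+ 2 / Zb <= V)%R.
  pose s := (Za / Zb)%R.
  have -> : (Za ^+ 2 / Zb = 2 * s * Za - s ^+ 2 * Zb)%R.
    by rewrite /s; field; rewrite gt_eqF.
  rewrite -!bmeas_RintegralZl; [|exact: bmeas_expR..].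
  rewrite -bmeas_RintegralB; last 2 first.
  - exact/bmeasM/bmeas_expR/ba/bmeas_cst.
  - exact/bmeasM/bmeas_expR/bb/bmeas_cst.
  apply: bmeas_le_Rintegral; last 2 first.
  - exact: bmeas_expR.
  - move=> t; rewrite !expRD expRN.
    set x := expR (a t); set y := expR (b t); have y0 : (0 < y)%R := expR_gt0 _.
    rewrite -subr_ge0 (_ : _ - _ = (x - s * y) ^+ 2 / y)%R.
      by rewrite divr_ge0 ?sqr_ge0 ?ltW.
    by field; rewrite gt_eqF.
  - by apply: bmeasB; apply: bmeasM; (try exact: bmeas_cst); exact: bmeas_expR.
have lnW := ln_le_of_two_weights Za0 Zb0 W0 e0 WV CS.
have := donsker_varadhan rho pi bau; rewrite kullback_gibbs// bmeas_RintegralB//.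
have := kullback_ge0 rho pi; case: (kullback rho pi) => [k _|_ _|//]; last first.
  by rewrite !addye// leey.
rewrite -EFinD lee_fin => DV0; rewrite -EFinD lee_fin.
have DV : (\int[rho]_t (a t + u t) <= k + ln W)%R by [].
suff : (\int[rho]_t (a t + u t) - \int[rho]_t b t <=
  k + (ln Zb - \int[rho]_t b t) - 2 * ln eps)%R by [].
move: DV lnW; move: (ln W) (ln Zb) (\int[rho]_t (a t + u t))%R (\int[rho]_t b t)%R.
move=> *; lra.
Qed.

Section event.
Local Open Scope ring_scope.
Context (R : realType) (N : nat) (dX dY dTheta : measure_display).
Context (X : measurableType dX) (Y : measurableType dY).
Context (Theta : measurableType dTheta).
Hypothesis N_ge1 : (1 <= N)%N.
Hypothesis finY : finite_set [set: Y].
Hypothesis discreteY : forall B : set Y, measurable B.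
Variables (P : 'I_N -> probability (X * Y)%type R) (f : Theta -> X -> Y).
Hypothesis mf : measurable_fun [set: Theta * X] (fun p : Theta * X => f p.1 p.2).

Local Notation Omega := (N.-tuple (X * Y)).
Local Notation r := (@emp_risk _ _ _ Theta X Y R N f).
Local Notation risk := (@exp_risk _ _ _ Theta X Y R N f (prod_prob P)).

Definition risk_exponent (c : R) (t : Theta) : R := N%:R * ln (1 + c * risk t).

Definition emp_exponent (c : R) (w : Omega) (t : Theta) : R :=
  N%:R * ln (1 + c) * r w t.

Local Notation phi := risk_exponent.
Local Notation psi := emp_exponent.

Lemma bmeas_risk_exponent c : -1 < c -> bounded_measurable (phi c).
Proof.
move=> c1; apply/bmeasM/bmeas_ln_affine => //; first exact: bmeas_cst.
  exact: bmeas_exp_risk.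
exact: exp_risk_itv.
Qed.

Lemma bmeas_emp_exponent c w : bounded_measurable (psi c w).
Proof. by apply/bmeasM/bmeas_emp_risk => //; exact: bmeas_cst. Qed.

(** Markov's inequality for the average of exp(psi c1 - phi c1) and
    exp(psi c2 - phi c2), integrated with respect to pi_exp(- phi c2): each of
    the two has sample mean at most 1 for every theta, by [emp_risk_moment]. For
    c1 = - alpha and c2 = gamma, the conclusion is the hypothesis of
    [two_weight_variational] with a = - phi gamma, b = - psi gamma and
    u = psi (- alpha) - phi (- alpha). *)
Lemma two_weight_event (pi : probability Theta R) (c1 c2 eps : R) :
  -1 < c1 -> -1 < c2 -> 0 < eps ->
  exists A : set Omega, [/\ measurable A, ((1 - eps)%:E <= prod_prob P A)%E &
    forall w, A w ->
     \int[pi]_t (expR (- phi c2 t + (psi c1 w t - phi c1 t))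
               + expR (- phi c2 t + - phi c2 t - - psi c2 w t)) <=
     2 * \int[pi]_t expR (- phi c2 t) / eps].
Proof.
move=> h1 h2 e0; set Za := \int[pi]_t _.
have b1 := bmeas_risk_exponent h1; have b2 := bmeas_risk_exponent h2.
have ba := bmeasN b2.
have Za0 : 0 < Za by exact: Rintegral_expR_gt0.
pose k1 t := (2 * Za)^-1 * expR (- phi c2 t - phi c1 t).
pose k2 t := (2 * Za)^-1 * expR (- phi c2 t - phi c2 t).
have k10 t : 0 <= k1 t by rewrite mulr_ge0 ?expR_ge0// invr_ge0 mulr_ge0// ltW.
have k20 t : 0 <= k2 t by rewrite mulr_ge0 ?expR_ge0// invr_ge0 mulr_ge0// ltW.
have bk1 : bounded_measurable k1 by exact/bmeasM/bmeas_expR/bmeasB/b1/ba/bmeas_cst.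
have bk2 : bounded_measurable k2 by exact/bmeasM/bmeas_expR/bmeasB/b2/ba/bmeas_cst.
pose G (p : Theta * Omega) : \bar R :=
  ((k1 p.1)%:E * (expR (psi c1 p.2 p.1))%:E +
   (k2 p.1)%:E * (expR (psi c2 p.2 p.1))%:E)%E.
have mpsi c : measurable_fun [set: Theta * Omega] (fun p => expR (psi c p.2 p.1)).
  apply: measurableT_comp => //; apply: measurable_funM => //.
  exact: measurable_emp_risk.
have mpart k c : bounded_measurable k -> measurable_fun [set: Theta * Omega]
    (fun p => (k p.1)%:E * (expR (psi c p.2 p.1))%:E)%E.
  move=> [mk _]; apply: emeasurable_funM; apply/measurable_EFinP => //.
  exact: (measurableT_comp mk).
have mG : measurable_fun [set: Theta * Omega] G by apply: emeasurable_funD; exact: mpart.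
have G0 p : (0 <= G p)%E by rewrite adde_ge0// mule_ge0 ?lee_fin ?expR_ge0.
have mpsit c t : measurable_fun [set: Omega] (fun w => (expR (psi c w t))%:E).
  apply/measurable_EFinP.
  exact: (measurableT_comp (mpsi c) (pair1_measurable t)).
have IG : (\int[pi]_t \int[prod_prob P]_w G (t, w) <= 1)%E.
  have inner t : (\int[prod_prob P]_w G (t, w) <= (Za^-1 * expR (- phi c2 t))%:E)%E.
    rewrite /G/= ge0_integralD//; last 4 first.
    - by move=> w _; rewrite mule_ge0 ?lee_fin ?expR_ge0.
    - exact: (measurableT_comp (mpart k1 c1 bk1) (pair1_measurable t)).
    - by move=> w _; rewrite mule_ge0 ?lee_fin ?expR_ge0.
    - exact: (measurableT_comp (mpart k2 c2 bk2) (pair1_measurable t)).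
    rewrite !ge0_integralZl_EFin//; [|by move=> w _; rewrite lee_fin expR_ge0..].
    have M c (hc : -1 < c) := emp_risk_moment N_ge1 finY discreteY P mf t hc.
    have := leeD (lee_wpmul2l (x := (k1 t)%:E) (k10 t) (M c1 h1))
                 (lee_wpmul2l (x := (k2 t)%:E) (k20 t) (M c2 h2)).
    move=> /le_trans; apply; rewrite -!EFinM -EFinD lee_fin.
    rewrite /k1 /k2 -!mulrA -!expRD !subrK -mulr2n -[leLHS]mulr_natl.
    by rewrite invfM mulrA mulrA mulfV// mul1r.
  apply: (@le_trans _ _ (\int[pi]_t (Za^-1 * expR (- phi c2 t))%:E)%E).
    apply: ge0_le_integral => //.
    - by move=> t _; exact: integral_ge0.
    - exact: measurable_fun_fubini_tonelli_F.
    - by apply/measurable_EFinP; have [] := bmeasM (bmeas_cst _ Za^-1) (bmeas_expR ba).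
  rewrite bmeas_RintegralE; last exact/bmeasM/bmeas_expR/ba/bmeas_cst.
  by rewrite bmeas_RintegralZl ?mulVf ?gt_eqF//; exact: bmeas_expR.
have [A [mA PA HA]] := markov_prior e0 mG G0 IG.
exists A; split => // w Aw; have := HA w Aw.
have bpsi c := bmeas_emp_exponent c w.
have bS : bounded_measurable (fun t => expR (- phi c2 t + (psi c1 w t - phi c1 t))
               + expR (- phi c2 t + - phi c2 t - - psi c2 w t)).
  apply: bmeasD; apply: bmeas_expR; first exact/bmeasD/bmeasB/b1/bpsi.
  exact/bmeasB/bmeasN/bpsi/bmeasD.
under eq_integral => t _.
  have -> : G (t, w) = ((2 * Za)^-1 *
     (expR (- phi c2 t + (psi c1 w t - phi c1 t))
               + expR (- phi c2 t + - phi c2 t - - psi c2 w t)))%:E.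
    rewrite /G /k1 /k2 /= -!EFinM -EFinD; congr EFin.
    rewrite mulrDr -!mulrA -!expRD opprK; congr (_ * expR _ + _).
    by rewrite addrAC addrA.
  over.
rewrite bmeas_RintegralE; last exact/bmeasM/bS/bmeas_cst.
rewrite lee_fin bmeas_RintegralZl// ler_pdivrMl ?mulr_gt0// => /le_trans; apply.
Qed.

End event.

(** * The bound *)

Section bound_identity.
Context d dX dY (Theta : measurableType d) (X : measurableType dX)
  (Y : measurableType dY) (R : realType) (N : nat).
Variables (f : Theta -> X -> Y) (pi rho : probability Theta R).
Variables (w : N.-tuple (X * Y)) (eps alpha gamma : R).
Hypotheses (N_ge1 : (1 <= N)%N) (gamma_gt0 : (0 < gamma)%R)
  (gamma_lt_alpha : (gamma < alpha)%R) (alpha_lt1 : (alpha < 1)%R).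

Local Notation r := (@emp_risk _ _ _ Theta X Y R N f w).
Hypothesis br : bounded_measurable r.
Hypothesis r_ge0 : forall t, (0 <= r t)%R.

Let K := kullback rho (gibbs pi (fun t => - (N%:R * ln (1 + gamma) * r t))%R).

Let Nd_gt0 : (0 < N%:R * (alpha - gamma))%R.
Proof. by rewrite mulr_gt0 ?ltr0n// subr_gt0. Qed.

Lemma bound1_fin k : K = k%:E -> bound1 f pi rho w eps alpha gamma =
  ((- (N%:R * ln ((1 - alpha) * (1 + gamma))) * (\int[rho]_t r t)%R + k - 2 * ln eps)
     / (N%:R * (alpha - gamma)))%:E.
Proof.
move=> Kk; rewrite /bound1 -/K Kk bmeas_RintegralE// -EFinB -2!EFinM -EFinD.
congr EFin; field; move: Nd_gt0.
by move=> /gt_eqF; rewrite mulf_eq0 => /negbT; rewrite negb_or andbC.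
Qed.

Lemma bound1_pinfty : K = +oo -> bound1 f pi rho w eps alpha gamma = +oo.
Proof.
move=> Koo; rewrite /bound1 -/K Koo bmeas_RintegralE// -EFinM.
by rewrite addye// gt0_mulye ?addey// lte_fin invr_gt0.
Qed.

(** Both divergences are expressed by K(rho, pi); the difference of the two
    logarithms of normalising constants is the integral over xi. *)
Lemma bound1_bound2 : bound1 f pi rho w eps alpha gamma =
  bound2 f pi rho w eps alpha gamma.
Proof.
have [[g0 ga] a1] := (gamma_gt0, gamma_lt_alpha, alpha_lt1).
have l1g : (0 < 1 + gamma)%R by lra.
have l1a : (0 < 1 - alpha)%R by lra.
have bexp (c : R) : bounded_measurable (fun t => c * r t)%R by exact/bmeasM/br/bmeas_cst.
have lnlt : (N%:R * ln (1 + gamma) < - (N%:R * ln (1 - alpha)))%R.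
  rewrite -mulrN ltr_pM2l ?ltr0n// -lnV ?posrE// ltr_ln ?posrE ?invr_gt0//.
  rewrite -[X in (_ < X)%R]mul1r ltr_pdivlMr//; nra.
rewrite /bound2 integral_gibbs_mean//.
have EA t : (- (- (N%:R * ln (1 - alpha)) * r t) = N%:R * ln (1 - alpha) * r t)%R.
  by rewrite mulNr opprK.
under [in X in (_ - ln X)%R]eq_Rintegral do rewrite EA.
have := kullback_gibbs rho pi (bexp (N%:R * ln (1 - alpha))%R) => ->.
have KE : K = _ := kullback_gibbs rho pi (bmeasN (bexp (N%:R * ln (1 + gamma))%R)).
have := kullback_ge0 rho pi; move: KE.
case: (kullback rho pi) => [k KE _|KE _|//]; last first.
  rewrite bound1_pinfty ?KE// !addye// gt0_mulye// lte_fin invr_gt0.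
  exact: Nd_gt0.
rewrite (bound1_fin KE) -!EFinD -EFinM; congr EFin.
have -> : (\int[rho]_t (- (N%:R * ln (1 + gamma) * r t)) =
    - (N%:R * ln (1 + gamma)) * \int[rho]_t r t)%R.
  under eq_Rintegral do rewrite -mulNr.
  by rewrite bmeas_RintegralZl.
rewrite bmeas_RintegralZl// lnM ?posrE//; congr (_ / _)%R.
move: (\int[rho]_t r t)%R (ln (\int[pi]_t _)%R) (ln (\int[pi]_t _)%R) => *; ring.
Qed.

End bound_identity.

Lemma risk_bound_fin (R : realType) (alpha gamma m : R) :
  risk_bound alpha gamma m%:E = ((alpha - gamma) / (2 * alpha * gamma) *
    (Num.sqrt (1 + 4 * alpha * gamma / (alpha - gamma) ^+ 2 *
       (1 - expR (- ((alpha - gamma) * m)))) - 1))%:E.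
Proof. by []. Qed.

Lemma risk_bound_pinfty (R : realType) (alpha gamma : R) :
  (gamma < alpha)%R ->
  risk_bound alpha gamma +oo = ((alpha - gamma) / (2 * alpha * gamma) *
    (Num.sqrt (1 + 4 * alpha * gamma / (alpha - gamma) ^+ 2 * (1 - 0)) - 1))%:E.
Proof.
move=> ga; rewrite /risk_bound gt0_muley ?lte_fin ?subr_gt0//=.
Qed.

Theorem theorem1p18 (R : realType) (N : nat) (N_ge1 : (1 <= N)%N)
  (dX dY dTheta : measure_display)
  (X : measurableType dX) (Y : measurableType dY)
  (Theta : measurableType dTheta)
  (cgX : countably_generated X) (cgTheta : countably_generated Theta)
  (finY : finite_set [set: Y]) (discreteY : forall B : set Y, measurable B)
  (P : 'I_N -> probability (X * Y)%type R)
  (f : Theta -> X -> Y)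
  (mf : measurable_fun [set: Theta * X] (fun p : Theta * X => f p.1 p.2))
  (pi : probability Theta R)
  (eps : R) (eps_gt0 : (0 < eps)%R) (eps_lt1 : (eps < 1)%R)
  (alpha gamma : R) (alpha_gt0 : (0 < alpha)%R) (gamma_gt0 : (0 < gamma)%R)
  (gamma_lt_alpha : (gamma < alpha)%R) (alpha_lt1 : (alpha < 1)%R) :
  (forall (rho : R.-pker (N.-tuple (X * Y)) ~> Theta) (w : N.-tuple (X * Y)),
     bound1 f pi (kernel_at rho w) w eps alpha gamma =
     bound2 f pi (kernel_at rho w) w eps alpha gamma) /\
  exists A : set (N.-tuple (X * Y)),
    [/\ measurable A,
        (1 - eps)%:E <= prod_prob P A &
        forall (rho : R.-pker (N.-tuple (X * Y)) ~> Theta)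
               (w : N.-tuple (X * Y)), A w ->
          let M := bound1 f pi (kernel_at rho w) w eps alpha gamma in
          \int[kernel_at rho w]_t (exp_risk f (prod_prob P) t)%:E
            <= risk_bound alpha gamma M /\
          risk_bound alpha gamma M <= M].
Proof.
have br (w : N.-tuple (X * Y)) : bounded_measurable (emp_risk R f w : Theta -> R).
  exact: (bmeas_emp_risk R N_ge1 finY discreteY mf).
have r0 (w : N.-tuple (X * Y)) t : (0 <= emp_risk R f w t :> R)%R.
  by have /andP[] := emp_risk_itv R N_ge1 f w t.
have r_itv := exp_risk_itv N_ge1 finY discreteY P mf.
have bR := bmeas_exp_risk N_ge1 finY discreteY P mf.
split=> [rho w|]; first exact: bound1_bound2.
have h1 : (-1 < - alpha)%R by lra.
have h2 : (-1 < gamma)%R by lra.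
have [A [mA PA HA]] :=
  two_weight_event N_ge1 finY discreteY P mf pi h1 h2 eps_gt0.
exists A; split => // rho0 w Aw M; rewrite {}/M.
set rho : probability Theta R := kernel_at rho0 w.
rewrite bmeas_RintegralE//; set x := (\int[rho]_t exp_risk f (prod_prob P) t)%R.
have x0 : (0 <= x)%R by apply: Rintegral_ge0 => t _; case/andP: (r_itv t).
have x1 : (x <= 1)%R.
  rewrite -[leRHS](prob_Rintegral_cst rho); apply: bmeas_le_Rintegral => //.
    exact: bmeas_cst.
  by move=> t; case/andP: (r_itv t).
have q1 : (0 < 1 - alpha * x)%R by nra.
have q2 : (0 < 1 + gamma * x)%R by nra.
have b1 := bmeas_risk_exponent N_ge1 finY discreteY P mf h1.
have b2 := bmeas_risk_exponent N_ge1 finY discreteY P mf h2.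
have p1 := bmeas_emp_exponent N_ge1 finY discreteY mf (- alpha) w.
have p2 := bmeas_emp_exponent N_ge1 finY discreteY mf gamma w.
have := two_weight_variational rho (bmeasN b2) (bmeasN p2) (bmeasB p1 b1) eps_gt0 (HA w Aw).
have := kullback_ge0 rho (gibbs pi (fun t => - (emp_exponent f gamma w t))%R).
case Kk : (kullback _ _) => [k|//|//] _ var; last first.
  (* An infinite divergence gives M = +oo, for which the exponential is 0. *)
  rewrite bound1_pinfty// risk_bound_pinfty// leey lee_fin; split => //.
  by apply: quadratic_root_ge => //; rewrite mulr_ge0 ?ltW.
rewrite (bound1_fin eps N_ge1 gamma_lt_alpha (br w) Kk)// risk_bound_fin !lee_fin.
set m := (_ / (N%:R * _))%R.
have N0 : (0 < N%:R :> R)%R by rewrite ltr0n.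
(* q(rho(R)) >= exp(- (alpha - gamma) m): the variational inequality followed
   by Jensen's inequality. *)
have key : (expR (- ((alpha - gamma) * m)) <= (1 - alpha * x) * (1 + gamma * x))%R.
  pose J := (\int[rho]_t (ln (1 - alpha * exp_risk f (prod_prob P) t) +
                           ln (1 + gamma * exp_risk f (prod_prob P) t)))%R.
  have Jq : (J <= ln ((1 - alpha * x) * (1 + gamma * x)))%R.
    exact: jensen_ln_quadratic.
  pose L := ln ((1 - alpha) * (1 + gamma)); pose rr := (\int[rho]_t emp_risk R f w t)%R.
  have bJ : bounded_measurable (fun t => ln (1 - alpha * exp_risk f (prod_prob P) t) +
                            ln (1 + gamma * exp_risk f (prod_prob P) t))%R.
    apply: bmeasD; last exact: bmeas_ln_affine.
    under [X in bounded_measurable X]eq_fun do rewrite -mulNr.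
    exact: bmeas_ln_affine.
  have varE : (- N%:R * J + N%:R * L * rr <= k - 2 * ln eps)%R.
    move: var; rewrite -EFinB lee_fin; apply: le_trans.
    rewrite le_eqVlt; apply/orP; left; apply/eqP.
    rewrite -!bmeas_RintegralZl// -bmeas_RintegralD; last 2 first.
    - exact/bmeasM/bJ/bmeas_cst.
    - exact/bmeasM/br/bmeas_cst.
    apply: eq_Rintegral => t _; rewrite /L lnM ?posrE; [|lra|lra].
    by rewrite /risk_exponent /emp_exponent !mulNr; ring.
  have mE : (N%:R * ((alpha - gamma) * m) = - (N%:R * L * rr) + k - 2 * ln eps)%R.
    rewrite /m -/L -/rr; field.
    by rewrite subr_eq0 gt_eqF// gt_eqF.
  rewrite -[leRHS]lnK ?posrE ?mulr_gt0// ler_expR (le_trans _ Jq)//.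
  by rewrite -(ler_pM2l N0) mulrN mE; move: varE; rewrite mulNr; lra.
split; first exact: quadratic_root_ge.
apply: quadratic_root_le => //.
rewrite -(pmulr_rge0 _ (_ : 0 < alpha - gamma)%R) ?subr_gt0// -oppr_le0.
rewrite -expR_le1 (le_trans key)//.
have lin0 : (0 <= (alpha - gamma) * x)%R by rewrite mulr_ge0// subr_ge0 ltW.
have quad0 : (0 <= alpha * gamma * x ^+ 2)%R.
  by rewrite mulr_ge0 ?sqr_ge0// mulr_ge0// ltW.
by rewrite -subr_ge0 (_ : _ - _ = (alpha - gamma) * x + alpha * gamma * x ^+ 2)%R;
  [rewrite addr_ge0|ring].
Qed.
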